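(* Every cuboid is canonically Ramsey. That is, for every positive integer $s$ and all positive real numbers $b_1,\dots,b_s$, there is a positive integer $n$ such that every colouring of the points of $\mathbb{R}^n$, with any (possibly infinite) number of colours, admits either a monochromatic copy or a rainbow copy of $R=\{0,b_1\}\times\cdots\times\{0,b_s\}\subset\mathbb{R}^s$.
   Context: A cuboid is a set of the form $\{0,b_1\}\times\cdots\times\{0,b_s\}\subset\mathbb{R}^s$ (the $2^s$ vertices of a box; $s$ may be larger than three). For $n<n'$, $\mathbb{R}^n$ is embedded in $\mathbb{R}^{n'}$ in the usual way (appending zero coordinates). A copy of a set $C$ is a set of points congruent (isometric) to $C$. Given a colouring, a set of points is monochromatic if all its points receive the same colour, and rainbow if its points receive pairwise different colours. A finite set $C$ is canonically Ramsey if there is some positive integer $n$ such that every colouring of the points of $\mathbb{R}^n$, with no restriction on the number of colours, admits either a monochromatic copy or a rainbow copy of $C$. *)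

(* Defs.v *)
From HB Require Import structures.
From mathcomp Require Import all_boot all_order all_algebra.
From mathcomp Require Import boolp classical_sets reals.

Set Implicit Arguments.
Unset Strict Implicit.
Unset Printing Implicit Defensive.

Import Order.TTheory GRing.Theory Num.Theory.
Local Open Scope classical_set_scope.
Local Open Scope ring_scope.

(* The norm that MathComp-Analysis puts on matrices is the sup norm, hence an
   explicit Euclidean distance. *)
Definition edist (R : realType) (n : nat) (x y : 'rV[R]_n) : R :=
  Num.sqrt (\sum_(i < n) (x 0 i - y 0 i) ^+ 2).

(* The two sets may live in different dimensions: appending zero coordinates
   preserves distances, so no explicit embedding is needed. The values of f
   outside A are irrelevant. *)
Definition copy_of (R : realType) (m n : nat)
    (A : set 'rV[R]_m) (B : set 'rV[R]_n) : Prop :=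
  exists f : 'rV[R]_m -> 'rV[R]_n,
    (forall x y, A x -> A y -> edist (f x) (f y) = edist x y) /\ B = f @` A.

Definition monochromatic (P K : Type) (c : P -> K) (A : set P) : Prop :=
  forall x y, A x -> A y -> c x = c y.

Definition rainbow (P K : Type) (c : P -> K) (A : set P) : Prop :=
  forall x y, A x -> A y -> x <> y -> c x <> c y.

Definition canonically_ramsey (R : realType) (s : nat) (C : set 'rV[R]_s) : Prop :=
  exists n : nat, (0 < n)%N /\
    forall (K : Type) (c : 'rV[R]_n -> K),
      exists B : set 'rV[R]_n,
        copy_of C B /\ (monochromatic c B \/ rainbow c B).

Definition cuboid (R : realType) (s : nat) (b : 'I_s -> R) : set 'rV[R]_s :=
  [set x | forall i, x 0 i = 0 \/ x 0 i = b i].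

(* Main.v *)
(* In a large product of regular simplices, product Ramsey for pairs yields a
   combinatorial box on which two vertices have the same colour exactly when they
   agree on some set J of coordinates. A copy of the cuboid in this box is a choice
   of disjoint blocks of coordinates, the squared sides in the i-th block summing
   to b_i^2; it is rainbow if every block meets J and monochromatic if none does.
   The squared sides are chosen in advance so that, whatever J is, one of the two
   can be achieved. *)
Require Import Defs.
From mathcomp Require Import all_boot all_order all_algebra.
From mathcomp Require Import boolp classical_sets reals.

Set Implicit Arguments.
Unset Strict Implicit.
Unset Printing Implicit Defensive.

Import Order.TTheory GRing.Theory Num.Theory.

Local Open Scope ring_scope.

(** * Ramsey's theorem for pairs and its product version *)

Section Ramsey.
Local Open Scope nat_scope.

Lemma pigeonhole_count (T : Type) (C : finType) (f : T -> C) (n : nat)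
    (s : seq T) :
  #|C| * n < size s -> exists a, n < count (fun x => f x == a) s.
Proof.
move=> hs; apply/existsP; apply: contraLR hs => /existsPn h.
rewrite -leqNgt.
have -> : size s = \sum_a count (fun x => f x == a) s.
  elim: s {h} => [|x s IH] /=; first by rewrite big1.
  rewrite big_split /= -IH (bigD1 (f x)) //= eqxx big1 // => a.
  by rewrite eq_sym => /negbTE ->.
rewrite -sum_nat_const; apply: leq_sum => a _.
by rewrite leqNgt; exact: h.
Qed.

(** Greedy choice: keep the first element, restrict the tail to the most useful colour class seen
    from it, and repeat. Each tag is the colour of all pairs formed with later elements. *)
Lemma end_homogeneous (T : eqType) (C : finType) (L : nat) :
  exists N, forall (chi : T -> T -> C) (s : seq T), N <= size s ->
  exists t : seq (T * C),
    [/\ subseq (unzip1 t) s, size t = L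
      & pairwise (fun p q => chi p.1 q.1 == p.2) t].
Proof.
elim: L => [|L [N IH]].
  by exists 0 => chi s _; exists [::]; split=> //=; exact: sub0seq.
exists (#|C| * N).+2 => chi [//|a s] /= hs.
have [c hc] := pigeonhole_count (chi a) hs.
have [|t [t_s st ht]] := IH chi [seq x <- s | chi a x == c].
  by rewrite size_filter ltnW.
exists ((a, c) :: t); split; rewrite /= ?st //.
  by rewrite eqxx; exact: subseq_trans t_s (filter_subseq _ _).
rewrite ht andbT; apply/allP => -[x d] xt /=.
have : x \in unzip1 t by apply/mapP; exists (x, d).
by move/(mem_subseq t_s); rewrite mem_filter => /andP[].
Qed.

(** In an end-homogeneous sequence, the elements sharing one tag span pairs of a single colour, and
    some tag occurs more than [m] times. *)
Lemma ramsey_pairs (C : finType) (m : nat) :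
  exists N, forall chi : nat -> nat -> C, exists e : nat -> nat, exists col : C,
    [/\ forall u, u < m -> e u < N,
        forall u v, u < v < m -> e u < e v
      & forall u v, u < v < m -> chi (e u) (e v) = col].
Proof.
have [N hN] := end_homogeneous nat C (#|C| * m).+1.
exists N => chi.
have [|t [t_s st ht]] := hN chi (iota 0 N); first by rewrite size_iota.
have [|col] := @pigeonhole_count _ _ snd m t; first by rewrite st.
rewrite -size_filter; set t' := filter _ t => hm.
have t'_s : subseq (unzip1 t') (iota 0 N).
  by apply: subseq_trans t_s; apply: map_subseq; exact: filter_subseq.
have st' : size (unzip1 t') = size t' by rewrite size_map.
exists (nth 0 (unzip1 t')), col; split.
- move=> u um.
  have : nth 0 (unzip1 t') u \in iota 0 N.
    by apply: (mem_subseq t'_s); rewrite mem_nth// st' (ltn_trans um).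
  by rewrite mem_iota.
- move=> u v /andP[uv vm].
  apply: (sorted_ltn_nth ltn_trans) => //.
  + exact: (subseq_sorted ltn_trans t'_s (iota_ltn_sorted _ _)).
  + by rewrite inE st' (ltn_trans uv)// (ltn_trans vm).
  + by rewrite inE st' (ltn_trans vm).
- move=> u v /andP[uv vm].
  have vt : v < size t' by exact: ltn_trans hm.
  have ut : u < size t' by exact: ltn_trans vt.
  have ht' : pairwise (fun p q => chi p.1 q.1 == p.2) t'.
    by rewrite (subseq_pairwise (filter_subseq _ _) ht).
  rewrite !(nth_map (0, col))//.
  have /pairwiseP -/(_ (0, col) u v ut vt uv)/eqP -> := ht'.
  have := mem_nth (0, col) ut.
  by rewrite mem_filter => /andP[/eqP].
Qed.

Definition upd (I : eqType) (T : Type) (P : I -> T) (i : I) (a : T) : I -> T :=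
  fun k => if k == i then a else P k.

(** Induction on the coordinates. [C] is quantified last because the inductive step enlarges the
    colour set; [P0] freezes the coordinates not yet treated. *)
Lemma product_ramsey_seq (I : eqType) (m : nat) (s : seq I) : uniq s ->
  forall C : finType, exists N,
  forall (chi : (I -> nat * nat) -> C) (P0 : I -> nat * nat),
  exists e : I -> nat -> nat, exists col : C,
    [/\ forall i u, i \in s -> u < m -> e i u < N,
        forall i u v, i \in s -> u < v < m -> e i u < e i v
      & forall P : I -> nat * nat,
          (forall i, i \in s ->
             exists u v, u < v < m /\ P i = (e i u, e i v)) ->
          (forall i, i \notin s -> P i = P0 i) -> chi P = col].
Proof.
elim: s => [_ C|i s IH /= /andP[iNs us] C].
  exists 0 => chi P0; exists (fun _ => id), (chi P0); split=> // P _ PP0.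
  by congr chi; apply: funext => i; exact: PP0.
have [N1 hN1] := ramsey_pairs C m.
have [N2 hN2] := IH us {ffun 'I_N1 * 'I_N1 -> C}.
exists (maxn N1 N2) => chi P0.
(* The new colour is the whole table of [chi] over pairs below [N1] at coordinate [i]. Once this
   table is constant, it is itself a colouring of pairs. *)
pose chi' P := [ffun Q : 'I_N1 * 'I_N1 =>
  chi (upd P i (nat_of_ord Q.1, nat_of_ord Q.2))].
have [e [col [eN elt ecol]]] := hN2 chi' P0.
(* The default [chi P0] only makes the colouring total: [e1] takes values below [N1]. *)
have [e1 [col1 [e1N e1lt e1col]]] := hN1 (fun a b =>
  if (insub a : option 'I_N1) is Some a' then
    if (insub b : option 'I_N1) is Some b' then col (a', b') else chi P0
  else chi P0).
exists (upd e i e1), col1; split.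
- move=> k u; rewrite inE /upd; case: eqP => [_ _ um|_ /= ks um].
    by rewrite leq_max e1N.
  by rewrite leq_max eN // orbT.
- move=> k u v; rewrite inE /upd; case: eqP => [_ _|_ /= ks]; first exact: e1lt.
  exact: elt.
- move=> P hP PP0.
  have [u [v [/[dup] uvm /andP[uv vm]]]] := hP i (mem_head _ _).
  rewrite /upd eqxx => Pi.
  rewrite -(e1col u v uvm).
  rewrite (insubT (fun k => k < N1) (e1N _ (ltn_trans uv vm))).
  rewrite (insubT (fun k => k < N1) (e1N _ vm)).
  (* Coordinate [i] is reset to its frozen value, which [chi'] overwrites anyway. *)
  rewrite -(ecol (upd P i (P0 i))).
  + rewrite /chi' ffunE /= -Pi; congr chi; apply: funext => k.
    by rewrite /upd; case: eqP => [->|].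
  + move=> k ks; have [|u' [v' [uv' Pk]]] := hP k; first by rewrite inE ks orbT.
    move: Pk; rewrite /upd; case: eqP => [ki|_ ->]; last by exists u', v'.
    by rewrite -ki ks in iNs.
  + move=> k kNs; rewrite /upd; case: eqP => [->//|/eqP ki].
    by apply: PP0; rewrite inE negb_or ki.
Qed.

Lemma product_ramsey (I C : finType) (m : nat) : exists N,
  forall chi : (I -> nat * nat) -> C,
  exists e : I -> nat -> nat,
    [/\ forall i u, u < m -> e i u < N,
        forall i u v, u < v < m -> e i u < e i v
      & forall u v u' v' : I -> nat,
          (forall i, u i < v i < m) -> (forall i, u' i < v' i < m) ->
          chi (fun i => (e i (u i), e i (v i))) =
          chi (fun i => (e i (u' i), e i (v' i)))].
Proof.
have [N hN] := product_ramsey_seq m (enum_uniq I) C.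
exists N => chi; have [e [col [eN elt ecol]]] := hN chi (fun=> (0, 0)).
exists e; split=> [i u|i u v|u v u' v' uv uv'].
- by apply: eN; rewrite mem_enum.
- by apply: elt; rewrite mem_enum.
- rewrite !ecol // => i; rewrite ?mem_enum // => _.
    by exists (u' i), (v' i).
  by exists (u i), (v i).
Qed.

(** * Canonical colour pattern on a combinatorial box *)

(* Four levels per coordinate are needed only to compare boxes; the canonical
   box is the one spanned by the two middle levels 1 and 2. *)
Lemma canonical_box (I : finType) : exists N,
  forall (K : Type) (c : (I -> nat) -> K),
  exists e : I -> bool -> nat, exists J : {set I},
    [/\ forall i x, e i x < N,
        forall i, e i false <> e i true
      & forall x y : I -> bool,
          c (fun i => e i (x i)) = c (fun i => e i (y i)) <->
          (forall i, i \in J -> x i = y i)].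
Proof.
pose B := {ffun I -> bool}.
have [N hN] := product_ramsey I {ffun B * B -> bool} 4.
exists N => K c.
pose sel (u v : I -> nat) (x : I -> bool) i := if x i then v i else u i.
(* A box is coloured by the equality pattern of [c] on its vertices, a finite colour set even when
   [K] is infinite. *)
pose chi (P : I -> nat * nat) := [ffun xy : B * B =>
  `[< c (sel (fun i => (P i).1) (fun i => (P i).2) xy.1) =
      c (sel (fun i => (P i).1) (fun i => (P i).2) xy.2) >]].
have [e [eN elt echi]] := hN chi.
pose d (w : I -> nat) := c (fun i => e i (w i)).
have box u v u' v' (x y : I -> bool) :
    (forall i, u i < v i < 4) -> (forall i, u' i < v' i < 4) ->
    d (sel u v x) = d (sel u v y) -> d (sel u' v' x) = d (sel u' v' y).
  move=> uv uv'; have /ffunP/(_ (finfun x, finfun y)) := echi _ _ _ _ uv uv'.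
  rewrite !ffunE /=.
  have E u1 v1 z : c (sel (fun i => e i (u1 i)) (fun i => e i (v1 i)) (finfun z))
      = d (sel u1 v1 z).
    by congr c; apply: funext => i; rewrite /sel ffunE; case: (z i).
  by rewrite !E => h; exact: (asbool_eq_equiv h).1.
pose lev (x : I -> bool) i := if x i then 2 else 1.
pose neutral k := forall x, d (lev (upd x k false)) = d (lev (upd x k true)).
have neutralP x y k : d (lev x) = d (lev y) -> x k = false -> y k = true ->
    neutral k.
  (* Raising level 2 of y at k to 3 keeps the colour equal to that of x, so levels
     2 and 3 at k are equivalent next to y. Levels 0 and 3 let a box with this
     pattern be placed around an arbitrary t. *)
  move=> xy xk yk t.
  have y23 : d (sel (upd (fun=> 1) k 2) (upd (fun=> 2) k 3) (upd y k false)) =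
             d (sel (upd (fun=> 1) k 2) (upd (fun=> 2) k 3) (upd y k true)).
    have xy' : d (sel (fun=> 1) (upd (fun=> 2) k 3) x) =
               d (sel (fun=> 1) (upd (fun=> 2) k 3) y).
      apply: (box (fun=> 1) (fun=> 2)) => // i.
      by rewrite /upd; case: eqP.
    transitivity (d (lev y)).
      congr d; apply: funext => i; rewrite /sel /upd /lev.
      by case: eqP => [->|_]; rewrite ?yk.
    rewrite -xy; transitivity (d (sel (fun=> 1) (upd (fun=> 2) k 3) x)).
      congr d; apply: funext => i; rewrite /sel /upd /lev.
      by case: eqP => [->|_]; rewrite ?xk.
    rewrite xy'; congr d; apply: funext => i; rewrite /sel /upd.
    by case: eqP => [->|_]; rewrite ?yk.
  pose u' := upd (fun l => if y l then 0 else lev t l) k 1.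
  pose v' := upd (fun l => if y l then lev t l else 3) k 2.
  have := @box _ _ u' v' _ _ _ _ y23.
  have E b : sel u' v' (upd y k b) = lev (upd t k b).
    apply: funext => i; rewrite /sel /u' /v' /lev /upd.
    by case: eqP => // _; case: (y i).
  rewrite !E; apply=> i; rewrite /u' /v' /upd /lev.
    by case: eqP.
  by case: eqP => // _; case: (y i); case: (t i).
exists (fun i b => e i (if b then 2 else 1)), [set k | ~~ `[< neutral k >]].
split=> [i []|i|x y]; [exact: eN|exact: eN| |].
  by move=> h; have := elt i 1 2 isT; rewrite h ltnn.
rewrite -/(d (lev x)) -/(d (lev y)); split=> [xy i|xy].
  rewrite inE; case xi: (x i); case yi: (y i) => // /asboolPn[].
    exact: (neutralP y x).
  exact: (neutralP x y).
(* Turn [x] into [y] one coordinate at a time: only neutral coordinates need to change, and they do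
   not affect the colour. [s] lists where the two may still differ. *)
suff H (s : seq I) : (forall i, i \notin s -> x i = y i) -> d (lev x) = d (lev y).
  by apply: (H (enum I)) => i; rewrite mem_enum.
elim: s x xy => [|k s IH] x xy hs.
  by congr (d (lev _)); apply: funext => i; exact: hs.
transitivity (d (lev (upd x k (y k)))); last first.
  apply: IH => i; rewrite /upd; case: eqP => [->//|/eqP ik].
    exact: xy.
  by move=> iNs; apply: hs; rewrite inE negb_or ik.
have [kn|kn] := pselect (neutral k); last first.
  congr (d (lev _)); apply: funext => i; rewrite /upd; case: eqP => // ->.
  by apply: xy; rewrite inE; apply/asboolPn.
have -> : d (lev x) = d (lev (upd x k (x k))).
  by congr (d (lev _)); apply: funext => i; rewrite /upd; case: eqP => // ->.
by case: (x k); case: (y k) => //; rewrite kn.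
Qed.

End Ramsey.

(** * Geometry of products of simplices *)

(* One simplex of squared side [wt i] for each coordinate [i]. *)
Definition simplex_point (R : realType) (I : finType) (wt : I -> R) (N : nat)
    (w : I -> nat) : 'rV[R]_#|{: I * 'I_N}| :=
  \row_j (let p : I * 'I_N := enum_val j in
          if w p.1 == p.2 then Num.sqrt (wt p.1 / 2) else 0).

(** Two distinct vertices of the [i]-th simplex differ in exactly two entries, each contributing
    [wt i / 2] to the squared distance. *)
Lemma edist_simplex_point (R : realType) (I : finType) (wt : I -> R) (N : nat)
    (w w' : I -> nat) :
  (forall i, 0 <= wt i) -> (forall i, w i < N)%N -> (forall i, w' i < N)%N ->
  edist (simplex_point wt N w) (simplex_point wt N w') =
  Num.sqrt (\sum_i (if w i == w' i then 0 else wt i)).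
Proof.
move=> wt0 wN w'N; rewrite /edist; congr Num.sqrt.
pose F (p : I * 'I_N) : R :=
  ((if w p.1 == p.2 then Num.sqrt (wt p.1 / 2) else 0) -
   (if w' p.1 == p.2 then Num.sqrt (wt p.1 / 2) else 0)) ^+ 2.
transitivity (\sum_p F p).
  rewrite (reindex (@enum_val _ {: I * 'I_N})) /=; last first.
    exact: onW_bij (enum_val_bij _).
  by apply: eq_bigr => j _; rewrite !mxE.
rewrite -(pair_bigA _ (fun i a => F (i, a))) /=; apply: eq_bigr => i _.
have h : (Num.sqrt (wt i / 2)) ^+ 2 = wt i / 2.
  by rewrite sqr_sqrtr // divr_ge0.
case: eqP => [ww'|/eqP ww'].
  by rewrite big1 // => a _; rewrite /F /= ww' subrr expr0n.
rewrite (bigD1 (Ordinal (wN i))) //= (bigD1 (Ordinal (w'N i))) /=; last first.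
  by rewrite -val_eqE /= eq_sym.
rewrite big1 => [|a /andP[aw aw']]; rewrite /F /=.
  by rewrite !eqxx eq_sym (negbTE ww') sub0r subr0 sqrrN h addr0 -splitr.
move: aw aw'; rewrite -!val_eqE /= eq_sym => /negbTE ->.
by rewrite eq_sym => /negbTE ->; rewrite subrr expr0n.
Qed.

(** * Choice of the weights *)

(* Coordinate (j, i, k) belongs to the pool of index j. Subtracting the floor
   multiple q of b_j^2 from b_i^2 leaves r in [0, b_j^2[, and the pool contains
   the weights r, b_j^2 - r (summing to b_j^2) and copies of b_j^2. If J meets
   every pool then each b_j^2 is a sum of weights from pool j involving J; if J
   misses the pool j, every b_i^2 = r + q b_j^2 is a sum of weights from it. *)
Lemma cuboid_coordinates (R : realType) (s : nat) (b : 'I_s -> R) :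
  (0 < s)%N -> (forall i, 0 < b i) ->
  exists (I : finType) (wt : I -> R),
    [/\ (0 < #|I|)%N, forall k, 0 <= wt k
      & forall J : {set I}, exists sigma : I -> option 'I_s,
          (forall i, \sum_(k | sigma k == Some i) wt k = b i ^+ 2) /\
          ((forall i, exists2 k, k \in J & sigma k = Some i) \/
           (forall k, k \in J -> sigma k = None))].
Proof.
move=> s0 hb.
have b2 i : 0 < b i ^+ 2 by rewrite exprn_gt0.
pose q (j i : 'I_s) := Num.truncn (b i ^+ 2 / b j ^+ 2).
pose r (j i : 'I_s) := b i ^+ 2 - (q j i)%:R * b j ^+ 2.
have r0b j i : 0 <= r j i < b j ^+ 2.
  have /truncn_itv/andP[] : 0 <= b i ^+ 2 / b j ^+ 2 by rewrite divr_ge0 ?ltW.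
  rewrite -/(q j i) ler_pdivlMr // ltr_pdivrMr // => h1 h2.
  by rewrite subr_ge0 h1 /= ltrBlDl -[X in _ + X]mul1r -mulrDl natr1.
pose K := (\max_j \max_i q j i)%N.
have qK j i : (q j i <= K)%N.
  apply: leq_trans (leq_bigmax j).
  exact: (leq_bigmax (F := fun i => q j i)).
pose I : finType := ('I_s * 'I_s * (bool + 'I_K))%type.
pose wt (p : I) := match p.2 with
  | inl true => r p.1.1 p.1.2
  | inl false => b p.1.1 ^+ 2 - r p.1.1 p.1.2
  | inr _ => b p.1.1 ^+ 2
  end.
exists I, wt; split.
- by apply/card_gt0P; exists (Ordinal s0, Ordinal s0, inl true).
- move=> [[j i] [[]|k]]; rewrite /wt /=.
  + by have /andP[] := r0b j i.
  + by rewrite subr_ge0 ltW //; have /andP[] := r0b j i.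
  + exact: ltW.
have sumI (P : pred I) (F : I -> R) :
    \sum_(p | P p) F p =
    \sum_j \sum_i ((\sum_(x : bool | P (j, i, inl x)) F (j, i, inl x)) +
                   \sum_(k : 'I_K | P (j, i, inr k)) F (j, i, inr k)).
  pose G ji x := if P (ji, x) then F (ji, x) else 0.
  rewrite big_mkcond; transitivity (\sum_(p : I) G p.1 p.2).
    by apply: eq_bigr => -[].
  rewrite -(pair_bigA _ G) /=.
  transitivity (\sum_(ji : 'I_s * 'I_s) \sum_x G (ji.1, ji.2) x).
    by apply: eq_bigr => -[].
  rewrite -(pair_bigA _ (fun j i => \sum_x G (j, i) x)) /=.
  apply: eq_bigr => j _; apply: eq_bigr => i _.
  by rewrite big_sumType /= -!big_mkcond.
move=> J.
have [pool|] := pselect (forall j, exists i x, (j, i, x) \in J); last first.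
  move=> /existsNP[j /forallNP Jj].
  (* Pool [j] misses [J]: block [i] takes the weight [r j i] and [q j i] copies of [b j ^+ 2]. *)
  exists (fun p : I => match p.2 with
    | inl x => if (p.1.1 == j) && x then Some p.1.2 else None
    | inr k => if (p.1.1 == j) && (k < q j p.1.2)%N then Some p.1.2 else None
    end).
  split=> [i|]; last first.
    right=> -[[j' i] x] /= pJ; have [jj|_] := eqVneq j' j.
      by case: (Jj i); exists x; rewrite -jj.
    by case: x pJ.
  rewrite sumI (bigD1 j) //= [X in _ + X]big1 ?addr0 => [|j' /negbTE j'j]; last first.
    by rewrite big1 // => k _; rewrite !big1 ?addr0 // => x; rewrite j'j.
  rewrite (bigD1 i) //= [X in _ + X]big1 ?addr0 => [|i' /negbTE i'i]; last first.
    rewrite !big1 ?addr0 // => x; rewrite eqxx /=; case: ifP => // _.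
      by rewrite (inj_eq Some_inj) i'i.
    by rewrite (inj_eq Some_inj) i'i.
  rewrite eqxx /= big_mkcond big_bool /= eqxx addr0.
  rewrite (eq_bigl (fun k : 'I_K => (k < q j i)%N)) => [|k]; last first.
    by case: ifP => //; rewrite eqxx.
  rewrite /wt /= sumr_const.
  have -> : #|(fun k : 'I_K => (k < q j i)%N)| = q j i.
    rewrite -sum1_card.
    by rewrite (big_ord_narrow (qK j i)) /= sum1_card card_ord.
  by rewrite /r -[X in _ + X]mulr_natl subrK.
have /choice[g hg] : forall j, exists g : 'I_s * (bool + 'I_K), (j, g.1, g.2) \in J.
  by move=> j; have [i [x ?]] := pool j; exists (i, x).
(* Groups of total weight [b j ^+ 2]: the two complementary weights together, or one full copy.
   Block [j] is the group of the chosen element [g j] of [J]. *)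
pose same (x y : bool + 'I_K) := match x, y with
  | inl _, inl _ => true
  | inr k, inr l => k == l
  | _, _ => false
  end.
exists (fun p : I => if (p.1.2 == (g p.1.1).1) && same (g p.1.1).2 p.2
  then Some p.1.1 else None).
split=> [j|]; last first.
  left=> j; exists (j, (g j).1, (g j).2) => //=.
  by rewrite eqxx /same; case: (g j).2 => //= k; rewrite eqxx.
rewrite sumI (bigD1 j) //= [X in _ + X]big1 ?addr0 => [|j' /negbTE j'j]; last first.
  rewrite big1 // => i _; rewrite !big1 ?addr0 // => x;
    by case: ifP => //; rewrite (inj_eq Some_inj) j'j.
rewrite (bigD1 (g j).1) //= [X in _ + X]big1 ?addr0 => [|i /negbTE ij]; last first.
  by rewrite !big1 ?addr0 // => x; rewrite ij.
rewrite eqxx /wt /=; case: (g j).2 => [x|k] /=.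
  rewrite eqxx [X in _ + X]big1 // addr0 big_bool /=.
  by rewrite addrC subrK.
rewrite big1 // add0r (eq_bigl (pred1 k)) ?big_pred1_eq // => l /=.
by rewrite [l == k]eq_sym; case: ifP => //; rewrite eqxx.
Qed.

Theorem theorem1 (R : realType) (s : nat) (b : 'I_s -> R)
    (hs : (0 < s)%N) (hb : forall i, 0 < b i) :
  canonically_ramsey (cuboid b).
Proof.
have [I [wt [I0 wt0 hJ]]] := cuboid_coordinates hs hb.
have [N hN] := canonical_box I.
(* The successor makes the dimension positive whatever [N] is. *)
exists #|{: I * 'I_N.+1}|; split.
  by rewrite card_prod card_ord muln_gt0 I0.
move=> K c.
have [e [J [eN ene eJ]]] := hN K (fun w => c (simplex_point wt N.+1 w)).
have [sigma [sum_sigma sigmaJ]] := hJ J.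
(* All coordinates of block [i] switch together with [x 0 i]; those in no block stay fixed. *)
pose lev (x : 'rV[R]_s) k := if sigma k is Some i then x 0 i == b i else false.
pose f x := simplex_point wt N.+1 (fun k => e k (lev x k)).
exists (f @` cuboid b)%classic; split.
  exists f; split=> // x y xb yb.
  rewrite edist_simplex_point // => [|i|i]; last 2 first.
  - by rewrite ltnW // ltnS eN.
  - by rewrite ltnW // ltnS eN.
  congr Num.sqrt.
  (* Each [k] lies in at most one block, so exchanging the sums gives one term [b i ^+ 2] per side
     where [x] and [y] differ. *)
  transitivity (\sum_k \sum_(i | sigma k == Some i)
      if (x 0 i == b i) == (y 0 i == b i) then 0 else wt k).
    apply: eq_bigr => k _.
    have -> : (e k (lev x k) == e k (lev y k)) = (lev x k == lev y k).
      case: (lev x k); case: (lev y k); rewrite ?eqxx //; apply/eqP => h;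
        by apply: (ene k).
    rewrite /lev; case: (sigma k) => [i|]; last by rewrite big1.
    rewrite (eq_bigl (pred1 i)) ?big_pred1_eq //.
  rewrite (exchange_big_dep predT) //=; apply: eq_bigr => i _.
  have b0 : 0 == b i = false by rewrite lt_eqF.
  case: (xb i) (yb i) => -> [] ->; rewrite ?b0 ?eqxx /=.
  - by rewrite big1 // subrr expr0n.
  - by rewrite sum_sigma sub0r sqrrN.
  - by rewrite sum_sigma subr0.
  - by rewrite big1 // subrr expr0n.
(* If every block meets [J], equal colours force agreement on every side; if none does, all vertices
   agree on [J]. *)
case: sigmaJ => sigmaJ; [right|left] => _ _ [x xb <-] [y yb <-].
  move=> fxy /eJ xy; apply: fxy; congr f; apply/rowP => i.
  have [k kJ ki] := sigmaJ i; have := xy k kJ; rewrite /lev ki.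
  have b0 : 0 == b i = false by rewrite lt_eqF.
  by case: (xb i) (yb i) => -> [] ->; rewrite ?b0 ?eqxx.
by apply/eJ => k kJ; rewrite /lev sigmaJ.
Qed.
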